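(* Let $E$ be a finite set and $\mathcal{L}$ a set of subsets of $E$ such that the toggle group $T(\mathcal{L})$ acts transitively and imprimitively on $\mathcal{L}$ and contains a cycle of length $|\mathcal{L}|$. Then there exist disjoint sets $E_1,E_2$ and $\mathcal{L}_i\subseteq 2^{E_i}$ such that $\mathcal{L}=\mathcal{L}_1\otimes\mathcal{L}_2$, $|\mathcal{L}_1|\ge 2$, $|\mathcal{L}_2|\ge 2$, $\gcd(|\mathcal{L}_1|,|\mathcal{L}_2|)=1$, and $T(\mathcal{L}_1)$ contains a cycle of length $|\mathcal{L}_1|$ and $T(\mathcal{L}_2)$ contains a cycle of length $|\mathcal{L}_2|$.
   Context: For a finite ground set $E$ and a set $\mathcal{L}$ of subsets of $E$: for $e\in E$, the toggle $\tau_e:\mathcal{L}\to\mathcal{L}$ is defined by $\tau_e(X)=X\triangle\{e\}$ if $X\triangle\{e\}\in\mathcal{L}$, and $\tau_e(X)=X$ otherwise; the toggle group $T(\mathcal{L})$ is the subgroup of the symmetric group on $\mathcal{L}$ generated by $\{\tau_e: e\in E\}$. Convention: every ground-set element $e$ for which $\tau_e$ is the identity permutation is removed from the ground set. The action is imprimitive if there is a block system with block size strictly between $1$ and $|\mathcal{L}|$ (a block being a subset $\mathcal{B}$ with $g(\mathcal{B})=\mathcal{B}$ or $g(\mathcal{B})\cap\mathcal{B}=\emptyset$ for all $g\in T(\mathcal{L})$). For disjoint $E_1,E_2$ and $\mathcal{L}_i\subseteq 2^{E_i}$, the toggle-disjoint Cartesian product is $\mathcal{L}_1\otimes\mathcal{L}_2=\{X_1\cup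 X_2: X_1\in\mathcal{L}_1, X_2\in\mathcal{L}_2\}$. *)

(* Defs.v *)
From mathcomp Require Import all_boot all_fingroup.

Set Implicit Arguments.
Unset Strict Implicit.
Unset Printing Implicit Defensive.

Import GroupScope.

Section PermGroup.

Variables (T : finType) (G : {set {perm T}}).

Definition is_block (B : {set T}) : Prop :=
  forall g, g \in G -> g @: B = B \/ [disjoint g @: B & B].

Definition block_system (Q : {set {set T}}) (k : nat) : Prop :=
  [/\ partition Q [set: T],
      [acts G, on Q | 'P^*],
      forall B, B \in Q -> is_block B
    & forall B, B \in Q -> #|B| = k].

Definition imprimitive : Prop :=
  exists (Q : {set {set T}}) (k : nat), block_system Q k /\ 1 < k < #|T|.

End PermGroup.

(* [g] is a single cycle on [n] points, fixing every other point. *)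
Definition is_cycle (T : finType) (n : nat) (g : {perm T}) : Prop :=
  exists x, #|porbit g x| = n /\ perm_on (porbit g x) g.

Section Toggle.

Variable U : finType.
Implicit Types (E X Y : {set U}) (L : {set {set U}}) (e : U).

Definition symdiff X Y : {set U} := (X :\: Y) :|: (Y :\: X).

(* [insubd X Z] is [Z] viewed in the subtype [L] if [Z \in L], and [X]
   otherwise. *)
Definition toggle_fun L e (X : {X : {set U} | X \in L}) :
    {X : {set U} | X \in L} :=
  insubd X (symdiff (val X) [set e]).

Lemma symdiffK X e : symdiff (symdiff X [set e]) [set e] = X.
Proof.
apply/setP=> y; rewrite /symdiff !inE.
by case: (y \in X); case: (y == e).
Qed.

Lemma toggle_funK L e : involutive (@toggle_fun L e).
Proof.
move=> X; apply: val_inj; rewrite /toggle_fun !val_insubd.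
case: ifP => [|]; case: ifP => // LY; first by rewrite symdiffK.
  by rewrite LY.
by rewrite symdiffK (valP X).
Qed.

Definition toggle L e : {perm {X : {set U} | X \in L}} :=
  perm (inv_inj (@toggle_funK L e)).

Definition toggle_group E L : {group {perm {X : {set U} | X \in L}}} :=
  <<[set toggle L e | e in E]>>%G.

(* [L] is a set of subsets of the ground set [E], subject to the convention
   that ground-set elements whose toggle is the identity have been removed. *)
Definition set_system E L : Prop :=
  L \subset powerset E /\ (forall e, e \in E -> toggle L e != 1).

(* The toggle-disjoint Cartesian product, for families over disjoint ground
   sets. *)
Definition toggle_prod (L1 L2 : {set {set U}}) : {set {set U}} :=
  [set X1 :|: X2 | X1 in L1, X2 in L2].

Definition has_full_cycle E L : Prop :=
  exists2 g, g \in toggle_group E L & is_cycle #|L| g.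

End Toggle.

(* Main.v *)
(** Toggling [e] inside a block at one place forces, by connectivity, that [e]
    preserves every block; any other label moves each block either identically
    or as a whole, by a translation.  Hence [L] is the product of its traces on
    the set [I] of block-preserving labels and on the complement of [I].  The
    point is that blocks do not spread over the second factor: otherwise some
    translation by a set [S] with at least two elements would preserve [L],
    and it would pair up the orbits of every toggle without fixing any, so that
    all toggles would be even while [#|L|] is even, contradicting the existence
    of a cycle of length [#|L|].  The full cycle projects to a full cycle on
    each factor, and its order divides the lcm of the sizes of the factors,
    which are therefore coprime. *)
Require Import Defs.
From mathcomp Require Import all_boot all_fingroup.

Set Implicit Arguments.
Unset Strict Implicit.
Unset Printing Implicit Defensive.

Import GroupScope.

(** * Generated subgroups and fixed-point-free involutions *)

Lemma gen_ind (gT : finGroupType) (A : {set gT}) (P : gT -> Prop) :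
  P 1 -> (forall x y, P x -> y \in A -> P (x * y)) ->
  forall x, x \in <<A>> -> P x.
Proof.
move=> P1 PM x /gen_prodgP [n [c Ac ->]].
elim: n c Ac => [|n IHn] c Ac; first by rewrite big_ord0.
by rewrite big_ord_recr; apply: PM => //; apply: IHn => i.
Qed.

Lemma fixfree_involution_even (T : finType) (f : T -> T) (D : {set T}) :
  {in D, forall x, [/\ f x \in D, f (f x) = x & f x != x]} -> ~~ odd #|D|.
Proof.
have [n] := ubnP #|D|; elim: n D => // n IHn D leDn fD.
have [->|[x Dx]] := set_0Vmem D; first by rewrite cards0.
have [Dfx ffx fxN] := fD x Dx.
have Dfx' : f x \in D :\ x by rewrite !inE fxN.
rewrite (cardsD1 x) Dx (cardsD1 (f x)) Dfx' /= negbK; apply: IHn.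
  by move: leDn; rewrite (cardsD1 x) Dx (cardsD1 (f x)) Dfx'; apply: ltnW.
move=> y; rewrite !inE => /and3P[yfx yx Dy].
have [Dfy ffy fyN] := fD y Dy; split=> //; rewrite Dfy andbT.
by apply/andP; split; [apply: contra yx | apply: contra yfx] => /eqP e;
  rewrite -ffy e ?ffx.
Qed.

(** * Permutations that are a single cycle on the whole set *)

Section FullCycle.

Variable T : finType.
Implicit Types (g : {perm T}).

Lemma full_porbit g : is_cycle #|T| g -> forall x, porbit g x = [set: T].
Proof.
case=> x0 [c0 _] x.
have px0 : porbit g x0 = [set: T].
  by apply/eqP; rewrite eqEcard subsetT cardsT c0 /=.
have: x \in porbit g x0 by rewrite px0.
by rewrite -eq_porbit_mem => /eqP->.
Qed.

(** [odd_perm] is the parity of the number of points plus the number of orbits, and here there is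
    just one orbit. *)
Lemma full_cycle_odd g : is_cycle #|T| g -> odd_perm g = ~~ odd #|T|.
Proof.
move=> gc; case: (gc) => x0 _.
rewrite /odd_perm /=; have -> : porbits g = [set [set: T]].
  apply/setP=> B; rewrite inE; apply/imsetP/eqP => [[x _ ->]|->].
    exact: full_porbit.
  by exists x0; rewrite ?full_porbit.
by rewrite cards1 addbT.
Qed.

Lemma full_cycle_expg g : is_cycle #|T| g -> g ^+ #|T| = 1.
Proof.
move=> gc; apply/permP=> x.
by rewrite permX perm1 -cardsT -(full_porbit gc x) iter_porbit.
Qed.

Lemma full_cycle_order g n :
  is_cycle #|T| g -> 0 < n -> g ^+ n = 1 -> #|T| <= n.
Proof.
move=> gc n_gt0 gn; case: (gc) => x _.
rewrite -[in X in _ <= X](card_ord n) -[in X in X <= _]cardsT.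
apply: leq_trans (leq_imset_card (fun i : 'I_n => (g ^+ i) x) _).
apply: subset_leq_card; apply/subsetP=> y.
rewrite -(full_porbit gc x) => /porbitP [i ->].
apply/imsetP; exists (Ordinal (ltn_pmod i n_gt0)) => //=.
by rewrite (expg_mod _ gn).
Qed.

End FullCycle.

(** * Full cycles and equivariant maps *)

Section Factors.

Variable T : finType.
Implicit Types (g : {perm T}).

Lemma equivariant_expg (T1 : finType) (f : T -> T1) g (g1 : {perm T1}) n :
  (forall x, f (g x) = g1 (f x)) -> forall x, f ((g ^+ n) x) = (g1 ^+ n) (f x).
Proof.
by move=> fg x; elim: n => [|n IHn]; rewrite ?perm1 // !expgSr !permM fg IHn.
Qed.

Lemma full_cycle_factor (T1 : finType) (f : T -> T1) g (g1 : {perm T1}) :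
  (forall y, exists x, f x = y) -> (forall x, f (g x) = g1 (f x)) ->
  is_cycle #|T| g -> is_cycle #|T1| g1.
Proof.
move=> f_surj fg gc; case: (gc) => x _.
have fx_orbit y : y \in porbit g1 (f x).
  have [z <-] := f_surj y; have: z \in porbit g x by rewrite full_porbit.
  by case/porbitP=> n ->; rewrite (equivariant_expg n fg) mem_porbit.
exists (f x); split; last by apply/subsetP=> y _.
by rewrite -cardsT; congr #|pred_of_set _|; apply/setP=> y; rewrite fx_orbit inE.
Qed.

(** Joint injectivity makes the lcm an exponent killing [g], so [#|T|] is at most the lcm; joint
    surjectivity makes [#|T|] at least the product. A product bounded by the lcm forces gcd 1. *)
Lemma full_cycle_coprime (T1 T2 : finType) (f1 : T -> T1) (f2 : T -> T2)
    g (g1 : {perm T1}) (g2 : {perm T2}) :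
  (forall y1 y2, exists x, f1 x = y1 /\ f2 x = y2) ->
  (forall x y, f1 x = f1 y -> f2 x = f2 y -> x = y) ->
  (forall x, f1 (g x) = g1 (f1 x)) -> (forall x, f2 (g x) = g2 (f2 x)) ->
  is_cycle #|T| g -> coprime #|T1| #|T2|.
Proof.
move=> f_surj f_inj fg1 fg2 gc; case: (gc) => x0 _.
have T1_gt0 : 0 < #|T1| by apply/card_gt0P; exists (f1 x0).
have T2_gt0 : 0 < #|T2| by apply/card_gt0P; exists (f2 x0).
have g1c : is_cycle #|T1| g1.
  by apply: full_cycle_factor gc => // y; have [x []] := f_surj y (f2 x0); exists x.
have g2c : is_cycle #|T2| g2.
  by apply: full_cycle_factor gc => // y; have [x []] := f_surj (f1 x0) y; exists x.
set l := lcmn #|T1| #|T2|.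
have gl : g ^+ l = 1.
  have /dvdnP [a la] : #|T1| %| l by apply: dvdn_lcml.
  have /dvdnP [b lb] : #|T2| %| l by apply: dvdn_lcmr.
  apply/permP=> x; rewrite perm1; apply: f_inj.
    by rewrite (equivariant_expg _ fg1) la mulnC expgM full_cycle_expg //
      expg1n perm1.
  by rewrite (equivariant_expg _ fg2) lb mulnC expgM full_cycle_expg //
    expg1n perm1.
have l_gt0 : 0 < l by rewrite lcmn_gt0 T1_gt0.
have leT : #|T1| * #|T2| <= #|T|.
  rewrite -card_prod -cardsT.
  apply: leq_trans (leq_imset_card (fun x => (f1 x, f2 x)) _).
  apply: subset_leq_card; apply/subsetP=> -[y1 y2] _.
  by have [x [<- <-]] := f_surj y1 y2; apply: imset_f.
have le_l : #|T1| * #|T2| <= l.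
  exact: leq_trans leT (full_cycle_order gc l_gt0 gl).
rewrite /coprime -(eqn_pmul2l l_gt0) muln1 muln_lcm_gcd.
by rewrite eqn_leq le_l -muln_lcm_gcd leq_pmulr // gcdn_gt0 T1_gt0.
Qed.

End Factors.

(** * Toggles as partial translations, and connectivity of the set system *)

Section Toggles.

Variables (U : finType) (L : {set {set U}}).
Implicit Types (E X Y S D : {set U}) (e : U).
Local Notation TL := {X : {set U} | X \in L}.

Lemma card_system : #|{: TL}| = #|L|.
Proof. by rewrite card_sig; apply: eq_card. Qed.

Lemma in_symdiff X Y e : (e \in symdiff X Y) = (e \in X) (+) (e \in Y).
Proof. by rewrite !inE; case: (e \in X); case: (e \in Y). Qed.

Lemma symdiff0 X : symdiff X set0 = X.
Proof. by apply/setP=> x; rewrite in_symdiff inE addbF. Qed.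

Lemma symdiffA X Y S : symdiff X (symdiff Y S) = symdiff (symdiff X Y) S.
Proof. by apply/setP=> x; rewrite !in_symdiff addbA. Qed.

Lemma symdiffAC X Y S : symdiff (symdiff X Y) S = symdiff (symdiff X S) Y.
Proof. by apply/setP=> x; rewrite !in_symdiff addbAC. Qed.

Lemma symdiffKr X S : symdiff (symdiff X S) S = X.
Proof. by apply/setP=> x; rewrite !in_symdiff addbK. Qed.

Lemma symdiffI X Y : symdiff X (symdiff X Y) = Y.
Proof. by apply/setP=> x; rewrite !in_symdiff addKb. Qed.

Lemma symdiff1_neq X e : symdiff X [set e] != X.
Proof.
by apply/eqP=> /setP/(_ e); rewrite in_symdiff set11 addbT; case: (e \in X).
Qed.

Lemma val_toggle e (X : TL) :
  val (toggle L e X) =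
  if symdiff (val X) [set e] \in L then symdiff (val X) [set e] else val X.
Proof. by rewrite permE /toggle_fun val_insubd. Qed.

Lemma val_toggle_in e (X : TL) :
  symdiff (val X) [set e] \in L -> val (toggle L e X) = symdiff (val X) [set e].
Proof. by rewrite val_toggle => ->. Qed.

Lemma val_toggle_moved e (X : TL) :
  toggle L e X != X -> val (toggle L e X) = symdiff (val X) [set e].
Proof.
by rewrite -(inj_eq val_inj) val_toggle; case: ifP; rewrite ?eqxx.
Qed.

Lemma toggleK e : involutive (toggle L e).
Proof. by move=> X; rewrite !permE toggle_funK. Qed.

(** Connectivity: by transitivity every member is reached from [X] by a word in the toggles, along
    which the induction runs. *)
Lemma toggle_ind E (P : TL -> Prop) (X : TL) :
  [transitive toggle_group E L, on [set: TL] | 'P] ->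
  P X -> (forall (Y : TL) e, e \in E -> P Y -> P (toggle L e Y)) ->
  forall Y : TL, P Y.
Proof.
move=> tr PX PT Y.
have [g Gg ->] := atransP2 tr (in_setT X) (in_setT Y).
rewrite /= /aperm; move: g Gg; apply: gen_ind; first by rewrite perm1.
by move=> g h Pg /imsetP [e Ee ->]; rewrite permM; apply: PT.
Qed.

(* Translation by [S] pairs up the points of [L], and also the orbits of each
   toggle since those have the form [X] or [X, X + e]. *)
Lemma translation_rigid E S : has_full_cycle E L ->
  {in L, forall X, symdiff X S \in L} -> S = set0 \/ exists e, S = [set e].
Proof.
move=> [g Gg gc] LS.
have [->|S0] := eqVneq S set0; [by left | right].
case: (pickP (fun e => S == [set e])) => [e /eqP->|Sn1]; first by exists e.
have S_shift X Y : symdiff X S = symdiff X Y -> S = Y.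
  by move=> eXS; rewrite -(symdiffI X S) eXS symdiffI.
have LSE X : (symdiff X S \in L) = (X \in L).
  by apply/idP/idP=> /LS; rewrite ?symdiffKr.
pose a (X : TL) : TL := exist _ (symdiff (val X) S) (LS _ (valP X)).
have aK : involutive a by move=> X; apply: val_inj; rewrite /= symdiffKr.
have aN (X : TL) : a X != X.
  apply/eqP=> /(congr1 val) /=; rewrite -[RHS]symdiff0 => /S_shift S0'.
  by rewrite S0' eqxx in S0.
have evenT : ~~ odd #|{: TL}|.
  by rewrite -cardsT; apply: (@fixfree_involution_even _ a) => X _; rewrite inE.
have aT e (X : TL) : toggle L e (a X) = a (toggle L e X).
  by apply: val_inj; rewrite /= !val_toggle /= symdiffAC LSE; case: ifP.
have orbit_toggle e (X Y : TL) :
      (Y \in porbit (toggle L e) X) = (Y == X) || (Y == toggle L e X).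
  apply/porbitP/orP => [[n ->]|[] /eqP->]; last 2 first.
  - by exists 0; rewrite perm1.
  - by exists 1%N.
  elim: n => [|n [] /eqP IHn]; first by left; rewrite perm1.
    by right; rewrite expgSr permM IHn.
  by left; rewrite expgSr permM IHn toggleK.
have a_orbit e (X : TL) : a @: porbit (toggle L e) X = porbit (toggle L e) (a X).
  apply/setP=> Y; rewrite -[Y]aK (mem_imset _ _ (inv_inj aK)) !orbit_toggle.
  by rewrite aT !(inj_eq (inv_inj aK)).
have toggle_even e : odd_perm (toggle L e) = false.
  rewrite /odd_perm /= (negbTE evenT) /=; apply: negbTE.
  apply: (@fixfree_involution_even _ (fun B : {set TL} => a @: B)) => B.
  case/imsetP=> X _ ->.
  rewrite !a_orbit aK; split=> //; first exact: imset_f.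
  rewrite eq_porbit_mem orbit_toggle negb_or aN /=.
  (* An orbit fixed by the shift would give [a X = toggle L e X], hence [S = [set e]], which [Sn1]
     excludes. *)
  apply/eqP=> aX; have: toggle L e X != X by rewrite -aX aN.
  move/val_toggle_moved; rewrite -aX /= => /S_shift Se.
  by have := Sn1 e; rewrite Se eqxx.
have: odd_perm g = false.
  move: g Gg {gc}; apply: gen_ind; first exact: odd_perm1.
  by move=> x y ex /imsetP [e _ ->]; rewrite odd_permM ex toggle_even.
by move: gc; rewrite -card_system => /full_cycle_odd ->; rewrite (negbTE evenT).
Qed.

End Toggles.

(** * Inner and outer labels of an invariant partition, given by the fibres of [q] *)

Section Blocks.

Variables (U : finType) (E : {set U}) (L : {set {set U}}).
Local Notation TL := {X : {set U} | X \in L}.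
Local Notation tau := (toggle L).
Variables (rT : eqType) (q : TL -> rT).
Hypothesis tr : [transitive toggle_group E L, on [set: TL] | 'P].
Hypothesis tau_q : forall e X Y, e \in E -> q X = q Y -> q (tau e X) = q (tau e Y).
Implicit Types (X Y Z W : TL) (S : {set U}) (e : U).

Definition inner_labels : {set U} :=
  [set e in E | [exists X, (tau e X != X) && (q (tau e X) == q X)]].
Local Notation I := inner_labels.

(** What spreads along paths of toggles is the existence, in each fibre, of a member that [e] moves
    within the fibre; [tau_q] then extends this from one member to its whole fibre. *)
Lemma inner_preserve e X : e \in I -> q (tau e X) = q X.
Proof.
rewrite inE => /andP[Ee /existsP[X0 /andP[X0m /eqP X0q]]].
suff [Y [YX _ Yq]] : exists Y, [/\ q Y = q X, tau e Y != Y & q (tau e Y) = q Y].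
  by rewrite (tau_q Ee (esym YX)) Yq.
move: X; apply: (toggle_ind tr (X := X0)); first by exists X0.
move=> X f Ef [Y [YX Ym Yq]].
have [fX|fX] := eqVneq (q (tau f X)) (q X); first by exists Y; rewrite fX.
have fY : q (tau f Y) != q Y by rewrite YX (tau_q Ef YX).
have fYm : tau f Y != Y by apply: contraNneq fY => ->.
have vf := val_toggle_moved fYm; have ve := val_toggle_moved Ym.
have efY : tau f (tau e Y) != tau e Y.
  by apply: contraNneq fY => fe; rewrite -(tau_q Ef Yq) fe Yq.
have vfe := val_toggle_moved efY.
(* [f] changes the fibre, so it moves both [Y] and [tau e Y]. All four corners of the square spanned
   by [e] and [f] at [Y] thus lie in [L], and [tau f Y] is a witness in the new fibre. *)
have com : tau e (tau f Y) = tau f (tau e Y).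
  apply: val_inj; rewrite vfe ve symdiffAC -vf; apply: val_toggle_in.
  by rewrite vf symdiffAC -ve -vfe; apply: valP.
exists (tau f Y); rewrite com; split; [exact: tau_q | | exact: tau_q].
by rewrite (inj_eq perm_inj).
Qed.

(** An outer label that keeps a fibre fixes all its members, since moving one would make it inner;
    one that changes the fibre moves them all. So [S] is [set0] or [[set e]]. *)
Lemma outer_translate e X : e \in E -> e \notin I ->
  exists2 S : {set U}, S \subset E :\: I &
    forall Y, q Y = q X -> val (tau e Y) = symdiff (val Y) S.
Proof.
move=> Ee In.
have fixq Y : q (tau e Y) = q Y -> tau e Y = Y.
  move=> Yq; apply: contraNeq In => Ym; rewrite inE Ee.
  by apply/existsP; exists Y; rewrite Ym Yq eqxx.
have [Xq|Xq] := eqVneq (q (tau e X)) (q X).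
  exists set0 => [|Y YX]; first exact: sub0set.
  by rewrite symdiff0 fixq // (tau_q Ee YX) Xq.
exists [set e] => [|Y YX]; first by rewrite sub1set inE In.
apply: val_toggle_moved; apply: contraNneq Xq => Ye.
by rewrite -(tau_q Ee YX) Ye YX.
Qed.

(* Follow a path of toggles from [X] to [W], dropping the inner ones. *)
Lemma outer_path X W : exists2 S : {set U}, S \subset E :\: I &
  (forall Y, q Y = q X -> exists2 Z : TL, val Z = symdiff (val Y) S & q Z = q W) /\
  val W :\: I = symdiff (val X) S :\: I.
Proof.
move: W; apply: (toggle_ind tr (X := X)).
  exists set0; first exact: sub0set.
  by rewrite symdiff0; split=> // Y YX; exists Y; rewrite ?symdiff0.
move=> W f Ef [S SI [Sq SW]]; have [fI|fI] := boolP (f \in I).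
  exists S => //; split=> [Y /Sq [Z ZY ZW]|].
    by exists Z; rewrite // inner_preserve.
  rewrite -SW val_toggle; case: ifP => // _; apply/setP=> x.
  rewrite in_setD in_symdiff in_set1 in_setD.
  by case: eqP => [->|_]; rewrite ?fI ?addbF.
have [s sI sW] := outer_translate W Ef fI.
exists (symdiff S s).
  by rewrite subUset !subDset !subsetU ?SI ?sI ?orbT.
split=> [Y /Sq [Z ZY ZW]|].
  by exists (tau f Z); [rewrite sW // ZY symdiffA | apply: tau_q].
rewrite sW // symdiffA; apply/setP=> x.
move/setP/(_ x): SW; rewrite !in_setD !in_symdiff.
by case: (x \in I) => //= ->.
Qed.

(** Applying the outer part of a path from [X] to [Y] to [X] itself leaves the trace on [I] alone
    and produces that of [Y] off [I]. *)
Lemma outer_product X Y : (val X :&: I) :|: (val Y :&: ~: I) \in L.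
Proof.
have [S SI [Sq SY]] := outer_path X Y; have [Z ZX _] := Sq X erefl.
suff -> : (val X :&: I) :|: (val Y :&: ~: I) = val Z by apply: valP.
rewrite -setDE SY ZX; apply/setP=> x.
rewrite in_setU in_setI in_setD in_symdiff.
have [xI|_] := boolP (x \in I); last by rewrite andbF.
have /negbTE-> : x \notin S by apply: contraL xI => /(subsetP SI)/setDP[].
by rewrite addbF andbT orbF.
Qed.

(** The outer part [S] of a path from [X] to [Y] maps their common fibre to itself. This property
    passes to every fibre, so translation by [S] preserves [L] and [translation_rigid] applies. *)
Lemma block_outer_const X Y : has_full_cycle E L ->
  q X = q Y -> val X :&: ~: I = val Y :&: ~: I.
Proof.
move=> hc XY; have [S SI [Sq SY]] := outer_path X Y.
have Sall W : forall Y', q Y' = q W ->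
    exists2 Z : TL, val Z = symdiff (val Y') S & q Z = q W.
  move: W; apply: (toggle_ind tr (X := X)); first by rewrite {2}XY.
  move=> W f Ef IHW Y'; have [fI|fI] := boolP (f \in I).
    by rewrite inner_preserve //; apply: IHW.
  have [s _ sW] := outer_translate W Ef fI => Y'q.
  (* Go back by [f] into the fibre of [W], translate by [S] there, and return by [f]: both passages
     are translations by the same [s], which cancels. *)
  have fY'q : q (tau f Y') = q W by rewrite (tau_q Ef Y'q) toggleK.
  have [Z ZY ZW] := IHW _ fY'q; exists (tau f Z); last exact: tau_q.
  by rewrite sW // ZY symdiffAC -sW // toggleK.
have LS : {in L, forall A : {set U}, symdiff A S \in L}.
  move=> W LW; have [Z ZW _] := Sall (exist _ W LW) (exist _ W LW) erefl.
  by rewrite -ZW (valP Z).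
rewrite -!setDE SY; case: (translation_rigid hc LS) => [->|[e Se]].
  by rewrite symdiff0.
(* A singleton [S] would be an outer label that moves [X] inside its fibre, which makes it inner. *)
have [Z ZX Zq] := Sall X X erefl; rewrite Se in ZX SI.
have eX : tau e X = Z by apply: val_inj; rewrite val_toggle_in -?ZX ?(valP Z).
have /setDP[Ee /negP[]] := subsetP SI e (set11 e).
rewrite inE Ee; apply/existsP; exists X; rewrite eX Zq eqxx andbT.
by rewrite -(inj_eq val_inj) ZX symdiff1_neq.
Qed.

End Blocks.

(** * Traces of a set system and the product decomposition *)

Section Traces.

Variables (U : finType) (E : {set U}) (L : {set {set U}}).
Implicit Types (D X Y : {set U}) (e : U).
Local Notation TL := {X : {set U} | X \in L}.

Definition trace D : {set {set U}} := [set X :&: D | X in L].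

Lemma mem_trace D X : X \in L -> X :&: D \in trace D.
Proof. exact: imset_f. Qed.

(** The product property as an exchange condition inside [L], with no mention of the factors. *)
Definition splits D : Prop :=
  {in L &, forall X Y, (X :&: D) :|: (Y :&: ~: D) \in L}.

Lemma splitsC D : splits D -> splits (~: D).
Proof. by move=> sD X Y LX LY; rewrite setCK setUC sD. Qed.

Definition tproj D (X : TL) : {Y : {set U} | Y \in trace D} :=
  exist _ (val X :&: D) (mem_trace D (valP X)).

Lemma tproj_surj D (Y : {Y : {set U} | Y \in trace D}) :
  exists X : TL, tproj D X = Y.
Proof.
case/imsetP: (valP Y) => X LX YX; exists (exist _ X LX).
by apply: val_inj; rewrite /= -YX.
Qed.

Lemma trace_prod D : splits D -> L = toggle_prod (trace D) (trace (~: D)).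
Proof.
move=> sD; apply/setP=> X; apply/idP/imset2P => [LX|[A B]].
  exists (X :&: D) (X :&: ~: D); try exact: mem_trace.
  by rewrite -setIUr setUCr setIT.
by move=> /imsetP[Y LY ->] /imsetP[Z LZ ->] ->; apply: sD.
Qed.

Lemma symdiff_trace D X e : e \in D ->
  symdiff X [set e] :&: D = symdiff (X :&: D) [set e].
Proof.
move=> De; apply/setP=> x; rewrite in_setI !in_symdiff in_setI in_set1.
by case: eqP => [->|_]; rewrite ?De ?andbT ?addbF.
Qed.

Lemma symdiff_traceC D X e : e \notin D -> symdiff X [set e] :&: D = X :&: D.
Proof.
move=> De; apply/setP=> x; rewrite !in_setI in_symdiff in_set1.
by case: eqP => [->|_]; rewrite ?(negbTE De) ?andbF ?addbF.
Qed.

(** If the toggle is possible in the trace, some [Y] in [L] realizes the toggled trace; gluing it to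
    the rest of [X] shows that the toggle is possible in [L]. *)
Lemma tproj_toggle D e (X : TL) : splits D -> e \in D ->
  tproj D (toggle L e X) = toggle (trace D) e (tproj D X).
Proof.
move=> sD De; apply: val_inj; rewrite /= !val_toggle /= -symdiff_trace //.
case: ifP => [LX|/negbT LX]; first by rewrite mem_trace.
case: ifP => // /imsetP[Y LY YX]; case/negP: LX.
have -> : symdiff (val X) [set e] = (Y :&: D) :|: (val X :&: ~: D).
  rewrite -YX -(@symdiff_traceC (~: D) _ e) ?inE ?negbK //.
  by rewrite -setIUr setUCr setIT.
exact: sD (valP X).
Qed.

Lemma tproj_toggleC D e (X : TL) : e \notin D -> tproj D (toggle L e X) = tproj D X.
Proof.
move=> De; apply: val_inj; rewrite /= val_toggle.
by case: ifP => // _; rewrite symdiff_traceC.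
Qed.

(** Write [g] as a word in toggles and drop the letters outside [D], which do not affect the
    trace. *)
Lemma tproj_group D g : splits D -> g \in toggle_group E L ->
  exists2 h, h \in toggle_group (E :&: D) (trace D) &
    forall X : TL, tproj D (g X) = h (tproj D X).
Proof.
move=> sD; move: g; apply: gen_ind => [|g _ [h Gh gh] /imsetP[e Ee ->]].
  by exists 1 => [|X]; rewrite ?group1 // !perm1.
have [De|De] := boolP (e \in D); last first.
  by exists h => // X; rewrite permM tproj_toggleC.
exists (h * toggle (trace D) e) => [|X]; last by rewrite !permM tproj_toggle // gh.
by rewrite groupM // mem_gen // imset_f // inE Ee.
Qed.

Lemma trace_system D : splits D -> set_system E L ->
  set_system (E :&: D) (trace D).
Proof.
move=> sD [LE Etau]; split.
  apply/subsetP=> _ /imsetP[X LX ->]; rewrite powersetE setSI //.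
  by rewrite -powersetE (subsetP LE).
move=> e /setIP[Ee De]; apply: contra (Etau e Ee) => /eqP t1.
apply/eqP/permP=> X; rewrite perm1; apply/eqP/negPn/negP => /val_toggle_moved tX.
have := congr1 val (tproj_toggle X sD De).
rewrite t1 perm1 /= tX symdiff_trace // => /eqP.
by rewrite (negbTE (symdiff1_neq _ _)).
Qed.

Lemma trace_gt1 D (X Y : TL) : val X :&: D != val Y :&: D -> 1 < #|trace D|.
Proof.
by move=> XY; apply/card_gt1P; exists (val X :&: D), (val Y :&: D);
  split=> //; apply: mem_trace (valP _).
Qed.

Lemma trace_full_cycle D g : splits D ->
  g \in toggle_group E L -> is_cycle #|L| g -> has_full_cycle (E :&: D) (trace D).
Proof.
move=> sD Gg gc; have [h Gh gh] := tproj_group sD Gg; exists h => //.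
rewrite -card_system; apply: full_cycle_factor gh _; last by rewrite card_system.
exact: tproj_surj.
Qed.

Lemma trace_coprime D g : splits D ->
  g \in toggle_group E L -> is_cycle #|L| g -> coprime #|trace D| #|trace (~: D)|.
Proof.
move=> sD Gg gc; have [h1 _ gh1] := tproj_group sD Gg.
have [h2 _ gh2] := tproj_group (splitsC sD) Gg.
rewrite -[#|trace D|]card_system -[#|trace (~: D)|]card_system.
apply: full_cycle_coprime gh1 gh2 _; last by rewrite card_system.
  move=> Y1 Y2; have [X1 <-] := tproj_surj Y1; have [X2 <-] := tproj_surj Y2.
  pose X := (val X1 :&: D) :|: (val X2 :&: ~: D).
  have LX : X \in L by apply: sD (valP _) (valP _).
  exists (exist _ X LX).
  by split; apply: val_inj; rewrite /= setIUl -!setIA ?setICr ?[~: D :&: D]setIC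
    ?setICr ?setI0 ?setIid ?setU0 ?set0U.
move=> X Y /(congr1 val)/= eD /(congr1 val)/= eC; apply: val_inj.
by rewrite -[val X]setIT -[val Y]setIT -(setUCr D) !setIUr eD eC.
Qed.

End Traces.

(** * Block systems seen through the map [pblock Q] *)

Section BlockSystem.

Variables (T : finType) (G : {set {perm T}}) (Q : {set {set T}}) (k : nat).
Hypothesis bQ : block_system G Q k.

Lemma block_system_equivariant g x y : g \in G ->
  pblock Q x = pblock Q y -> pblock Q (g x) = pblock Q (g y).
Proof.
move=> Gg xy; case: bQ => /and3P[/eqP cQ tQ _] aQ _ _.
have Qx z : pblock Q z \in Q by rewrite pblock_mem // cQ inE.
have zQ z : z \in pblock Q z by rewrite mem_pblock cQ inE.
have gQ : g @: pblock Q x \in Q.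
  by have := acts_act aQ Gg (pblock Q x); rewrite Qx /= /setact.
rewrite (def_pblock tQ gQ (imset_f g (zQ x))) [RHS](def_pblock tQ gQ) //.
by rewrite imset_f // xy.
Qed.

Lemma block_pair : 1 < k -> 0 < #|T| ->
  exists x y, x != y /\ pblock Q x = pblock Q y.
Proof.
move=> k1 /card_gt0P[x0 _]; case: bQ => /and3P[/eqP cQ tQ _] _ _ kQ.
have Qx : pblock Q x0 \in Q by rewrite pblock_mem // cQ inE.
move: k1; rewrite -(kQ _ Qx) => /card_gt1P[x [y [xB yB xy]]].
by exists x, y; rewrite (def_pblock tQ Qx xB) (def_pblock tQ Qx yB).
Qed.

Lemma block_proper x : k < #|T| -> exists y, pblock Q y != pblock Q x.
Proof.
move=> kT; case: bQ => /and3P[/eqP cQ tQ _] _ _ kQ.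
have Qx z : pblock Q z \in Q by rewrite pblock_mem // cQ inE.
have: ~~ (setT \subset pblock Q x).
  by apply/negP=> /subset_leq_card; rewrite (kQ _ (Qx x)) cardsT leqNgt kT.
case/subsetPn=> y _ yx; exists y; apply: contraNneq yx => <-.
by rewrite mem_pblock cQ inE.
Qed.

End BlockSystem.

Theorem theorem4p2 (U : finType) (E : {set U}) (L : {set {set U}})
    (hL : set_system E L)
    (htrans : [transitive toggle_group E L,
                 on [set: {X : {set U} | X \in L}] | 'P])
    (himprim : imprimitive (toggle_group E L))
    (hcycle : has_full_cycle E L) :
  exists (E1 E2 : {set U}) (L1 L2 : {set {set U}}),
    [disjoint E1 & E2] /\
    set_system E1 L1 /\ set_system E2 L2 /\
    L = toggle_prod L1 L2 /\
    2 <= #|L1| /\ 2 <= #|L2| /\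
    coprime #|L1| #|L2| /\
    has_full_cycle E1 L1 /\ has_full_cycle E2 L2.
Proof.
case: himprim => Q [k [bQ /andP[k1 kn]]].
have tau_q e X Y : e \in E -> pblock Q X = pblock Q Y ->
    pblock Q (toggle L e X) = pblock Q (toggle L e Y).
  move=> Ee; apply: (block_system_equivariant bQ).
  by rewrite mem_gen ?imset_f.
pose D := inner_labels E (pblock Q).
have sD : splits L D.
  move=> X Y LX LY.
  exact: (outer_product htrans tau_q (exist _ X LX) (exist _ Y LY)).
have [X [Y [XY qXY]]] := block_pair bQ k1 (ltn_trans (ltnW k1) kn).
have eqC := block_outer_const htrans tau_q hcycle qXY.
(* Two distinct members of one block agree off [D], so they differ on [D]. *)
have D1 : 1 < #|trace L D|.
  apply: (@trace_gt1 _ _ _ X Y); apply: contraNneq XY => eqD.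
  apply/eqP/val_inj.
  by rewrite -[val X]setIT -[val Y]setIT -(setUCr D) !setIUr eqD eqC.
have C1 : 1 < #|trace L (~: D)|.
  pose moved (Z : {X : {set U} | X \in L}) := val Z :&: ~: D != val X :&: ~: D.
  case: (pickP moved) => [Z|cC].
    exact: trace_gt1.
  (* If all members agree off [D], no outer label ever moves anything, and inner labels keep each
     block; by connectivity there is a single block, against [kn]. *)
  have [Z /negP[]] := block_proper bQ X kn; apply/eqP.
  move: Z; apply: (toggle_ind htrans (X := X)) => // Z e Ee <-.
  have [eD|eD] := boolP (e \in D); first exact: (inner_preserve htrans tau_q).
  have [-> //|/val_toggle_moved tZ] := eqVneq (toggle L e Z) Z.
  have eC : e \in ~: D by rewrite inE eD.
  have := cC (toggle L e Z); rewrite /moved tZ symdiff_trace //.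
  have /negbFE/eqP-> := cC Z.
  by rewrite symdiff1_neq.
case: (hcycle) => g Gg gc.
exists (E :&: D), (E :&: ~: D), (trace L D), (trace L (~: D)).
split; first by rewrite -setI_eq0 setIACA setICr setI0.
have sC := splitsC sD.
split; first exact: trace_system.
split; first exact: trace_system.
split; first exact: trace_prod.
split=> //; split=> //; split; first exact: trace_coprime Gg gc.
by split; apply: trace_full_cycle Gg gc.
Qed.
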